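(* For every fixed real $r>0$, as $n\to\infty$, \[ \mathbb{E}\left[\left(\frac{K_n}{\sqrt n}\right)^r\right]\longrightarrow \Gamma\left(1+\frac r2\right). \] In particular, $\mathbb{E}K_n\sim\frac{\sqrt\pi}{2}\sqrt n$ and $\operatorname{Var}(K_n)\sim\left(1-\frac{\pi}{4}\right)n$. Equivalently (to the statement on $\mathbb{E}K_n$), $\mathbb{E}\tau_n=n-\frac{\sqrt\pi}{2}\sqrt n+o(\sqrt n)$.
   Context: Let $n\ge 3$ and let $C_n$ be the cycle graph on vertex set $\mathbb{Z}/n\mathbb{Z}$ ($v$ is adjacent to $v-1$ and $v+1$). Let $\pi=(\pi_1,\dots,\pi_n)$ be a uniformly random permutation (ordering) of the vertices, and $A_t=\{\pi_1,\dots,\pi_t\}$ for $0\le t\le n$. A vertex $v\in A_t$ is isolated at time $t$ if neither neighbor of $v$ lies in $A_t$. Define $\tau_n=\max\{t: \text{the induced subgraph } C_n[A_t]\text{ contains an isolated vertex}\}$ and $K_n=n-\tau_n$. Here $\Gamma$ is the Gamma function and $a_n\sim b_n$ means $a_n/b_n\to1$. *)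

(* Defs.v *)
From HB Require Import structures.
From mathcomp Require Import all_boot all_order all_algebra all_fingroup.
From mathcomp Require Import all_classical all_reals all_analysis.

Set Implicit Arguments.
Unset Strict Implicit.
Unset Printing Implicit Defensive.

Import Order.TTheory GRing.Theory Num.Theory.
Import numFieldNormedType.Exports.

Local Open Scope classical_set_scope.
Local Open Scope ring_scope.

(* [ord_pred] and [ordS] are v - 1 and v + 1 modulo n; this is C_n for [n >= 3]. *)
Definition cycle_adj (n : nat) : rel 'I_n :=
  fun u v => (v == ord_pred u) || (v == ordS u).

Definition isolated (T : finType) (e : rel T) (A : {set T}) (v : T) : bool :=
  (v \in A) && [forall u in A, ~~ e v u].

(* The ordering attached to [s : 'S_n] is [s 0, s 1, ..., s (n - 1)], so that
   [s i] is the [(i + 1)]-st vertex of the ordering. *)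
Definition first_vertices (n : nat) (s : 'S_n) (t : nat) : {set 'I_n} :=
  [set s i | i : 'I_n & (i < t)%N]%SET.

(* For [n >= 3] (indeed for [n >= 2]) the maximum is over a nonempty set, since
   a single vertex is isolated at time 1. *)
Definition last_isolated_time (n : nat) (s : 'S_n) : nat :=
  \max_(t < n.+1 | [exists v, isolated (@cycle_adj n) (first_vertices s t) v]) t.

Definition isolation_gap (n : nat) (s : 'S_n) : nat :=
  (n - last_isolated_time s)%N.

HB.instance Definition _ (T : finType) := isPointed.Build (perm_type T) 1%g.
HB.instance Definition _ (T : finType) :=
  @isMeasurable.Build default_measure_display (perm_type T)
    discrete_measurable discrete_measurable0
    discrete_measurableC discrete_measurableU.

Definition uniform_perm (R : realType) (n : nat) (A : set 'S_n) : \bar R :=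
  ((\sum_(s : 'S_n) \1_A s) / n`!%:R)%:E.

Section uniform_perm_probability.
Context (R : realType) (n : nat).
Local Open Scope ereal_scope.

Local Notation P := (@uniform_perm R n).

Let uniform_perm0 : P set0 = 0.
Proof. by rewrite /uniform_perm big1 ?mul0r// => s _; rewrite indic0. Qed.

Let uniform_perm_ge0 A : 0 <= P A.
Proof.
by rewrite lee_fin divr_ge0// sumr_ge0// => s _; rewrite indicE ler0n.
Qed.

Let uniform_perm_sigma_additive : semi_sigma_additive P.
Proof.
pose r := index_enum {perm 'I_n}.
have PE : P = mscale ((n`!%:R : R)^-1)%:nng%R
    (msum (fun i => \d_(nth 1%g r i)) (size r)).
  apply/funext => A; rewrite /mscale /msum /uniform_perm /= mulrC EFinM.
  by rewrite (big_nth 1%g) big_mkord -sumEFin.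
by rewrite PE; exact: measure_semi_sigma_additive.
Qed.

HB.instance Definition _ := isMeasure.Build _ _ _ P
  uniform_perm0 uniform_perm_ge0 uniform_perm_sigma_additive.

Let uniform_permT : P setT = 1.
Proof.
rewrite /uniform_perm (eq_bigr (fun=> 1%R)); last by move=> s _; rewrite indicT.
by rewrite sumr_const card_Sn divff// pnatr_eq0 -lt0n fact_gt0.
Qed.

HB.instance Definition _ :=
  Measure_isProbability.Build _ _ _ P uniform_permT.

End uniform_perm_probability.

(* Euler's integral. [Rintegral] is total and only gives Euler's Gamma when the
   integral converges, i.e. for [0 < x]. *)
Definition Gamma (R : realType) (x : R) : R :=
  \int[lebesgue_measure]_(t in `]0, +oo[) (t `^ (x - 1) * expR (- t)).

Definition asymp_equiv (R : realType) (a b : nat -> R) : Prop :=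
  a n / b n @[n --> \oo] --> (1 : R).

(* Main.v *)
Require Import Defs.
From HB Require Import structures.
From mathcomp Require Import all_boot all_order all_algebra all_fingroup.
From mathcomp Require Import all_classical all_reals all_analysis measurable_realfun.
From mathcomp Require Import ring lra zify.

Set Implicit Arguments.
Unset Strict Implicit.
Unset Printing Implicit Defensive.

Import Order.TTheory GRing.Theory Num.Theory.
Import numFieldNormedType.Exports.

Local Open Scope classical_set_scope.
Local Open Scope ring_scope.

(** Run the ordering backwards.  The set [B_k] of the last [k] vertices grows by
    one uniformly chosen new vertex at a time, and a vertex [v] is isolated in
    the complement of [B_k] exactly when [v] is not in [B_k] but both of its
    neighbours are: call this a hole.  So, for [k < n], [K_n > k] says that none
    of [B_0, ..., B_k] has a hole, and everything rests on the survival function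
    [q_k = P(K_n > k)].

    While there is no hole, a new vertex [u] creates one iff it lands two steps
    beyond the end of a run of [B_k], on either side; both sides contribute as
    many such fatal vertices as [B_k] has runs ([has_holeU1],
    [card_right_fatal], [card_left_fatal]).  There are thus at most [2 k] fatal
    vertices, and at least [2 k] minus a defect: twice the number of adjacent
    pairs of [B_k] plus the number of its pairs at distance four.  The mean
    defect is [O(k^2 / n)] ([mean_pairs_le]), so [q_{k+1}] is [(1 - 2 k / n) q_k] up to
    [O(k^2 / n^2)], and summing up gives [q_k = exp(- k^2 / n) + o(1)] for [k] of
    order [sqrt n] ([survival_lower_bound], [survival_upper_bound]).  That is,
    [K_n / sqrt n] converges in law to a variable with tail [exp(- z^2)]
    ([survival_cvg]).

    Moments of every order need a tail bound that is uniform in [n].  The mean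
    defect is useless for that, since long runs make the number of fatal
    vertices much smaller than [2 k]; but a process with few runs does not
    survive either, because a surviving step opens a new run unless it lands on
    one of the two sides of a run.  Weighting survival by [y ^ runs] with [y]
    increasing to [1] as the time approaches [k] captures both effects in a
    single induction ([weighted_survivalS], [weighted_survival_le]) and yields
    [q_k <= exp(- c k^2 / n)].

    The moment is then the integral over [t >= 0] of [P((K_n / sqrt n)^r > t)].
    Dominated convergence turns it into the integral of [exp(- t^(2 / r))], which
    is [Gamma (1 + r / 2)]: by Tonelli, it is the moment of order [r / 2] of an
    exponential variable ([Gamma_integral_expR]).  The values [r = 1], where the
    integral is Gauss's, and [r = 2] give the mean and the variance. *)

(** * The last vertices of a uniform ordering *)

Section removed_vertices.
Variables (n : nat).
Implicit Types (s : 'S_n) (k j : nat) (v w : 'I_n).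

Definition last_vertices s k : {set 'I_n} := (~: first_vertices s (n - k))%SET.

Lemma mem_last_vertices s k v :
  (v \in last_vertices s k) = (n - k <= (s^-1)%g v)%N.
Proof.
rewrite !inE leqNgt; congr (~~ _); apply/imsetP/idP => [[i]|lt].
  by rewrite inE => lt ->; rewrite permK.
by exists ((s^-1)%g v); rewrite ?inE// permKV.
Qed.

Lemma last_vertices0 s : last_vertices s 0 = finset.set0.
Proof.
apply/finset.setP => v; rewrite mem_last_vertices !inE subn0.
by apply/negbTE; rewrite -ltnNge ltn_ord.
Qed.

Lemma rev_ord_notin_last_vertices s (k : 'I_n) :
  s (rev_ord k) \notin last_vertices s k.
Proof. by rewrite mem_last_vertices permK /= -ltnNge; have := ltn_ord k; lia. Qed.

Lemma last_verticesS s (k : 'I_n) :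
  last_vertices s k.+1 = (s (rev_ord k) |: last_vertices s k)%SET.
Proof.
apply/finset.setP => v; rewrite in_setU1 !mem_last_vertices.
rewrite -(inj_eq (@perm_inj _ (s^-1)%g)) permK -val_eqE /=.
by have := ltn_ord k; lia.
Qed.

Lemma card_last_vertices s k : (k <= n)%N -> #|last_vertices s k| = k.
Proof.
elim: k => [|k IH] kn; first by rewrite last_vertices0 cards0.
rewrite (last_verticesS s (Ordinal kn)) cardsU1.
by rewrite (rev_ord_notin_last_vertices s (Ordinal kn)) /= IH// ltnW.
Qed.

(** Adaptedness to the reversed process.  The whole history [B_0, ..., B_k] is
    allowed, not just [B_k], because survival up to time [k] depends on it. *)
Definition depends_on_last k (T : Type) (f : 'S_n -> T) :=
  forall s s', (forall j, (j <= k)%N -> last_vertices s j = last_vertices s' j) ->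
  f s = f s'.

Variable R : realFieldType.

Definition mean (f : 'S_n -> R) : R := (\sum_s f s) / n`!%:R.

Lemma mean_cst (c : R) : mean (fun=> c) = c.
Proof.
by rewrite /mean sumr_const card_Sn -(mulr_natr c) mulfK// ?pnatr_eq0 -?lt0n ?fact_gt0.
Qed.

Lemma eq_mean f g : f =1 g -> mean f = mean g.
Proof. by move=> fg; rewrite /mean (eq_bigr g). Qed.

Lemma le_mean (f g : 'S_n -> R) : (forall s, f s <= g s) -> mean f <= mean g.
Proof.
by move=> fg; rewrite /mean ler_wpM2r ?invr_ge0//; apply: ler_sum => s _.
Qed.

Lemma meanD f g : mean (fun s => f s + g s) = mean f + mean g.
Proof. by rewrite /mean big_split mulrDl. Qed.

Lemma meanZ c f : mean (fun s => c * f s) = c * mean f.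
Proof. by rewrite /mean -mulr_sumr mulrA. Qed.

Lemma mean_ge0 f : (forall s, 0 <= f s) -> 0 <= mean f.
Proof. by move=> f0; rewrite -(mean_cst 0); exact: le_mean. Qed.

(** Given the last [k] vertices, the next one is uniform among the others:
    composing [s] with the transposition of [n - k - 1] and a smaller index
    changes the next vertex but not the last [k]. *)
Lemma mean_next_vertex (k : 'I_n) (f : 'S_n -> 'I_n -> R) :
  depends_on_last k f ->
  (n - k)%:R * mean (fun s => f s (s (rev_ord k))) =
  mean (fun s => \sum_(v in (~: last_vertices s k)%SET) f s v).
Proof.
move=> fk; rewrite /mean mulrA; congr (_ / _).
have -> : \sum_s \sum_(v in (~: last_vertices s k)%SET) f s v =
    \sum_s \sum_(i < n | (i < n - k)%N) f s (s i).
  apply: eq_bigr => s _; rewrite (reindex_inj (@perm_inj _ s)) /=.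
  apply: eq_bigl => i.
  by rewrite finset.in_setC mem_last_vertices permK -ltnNge.
rewrite [RHS]exchange_big /=.
rewrite [RHS](eq_bigr (fun=> \sum_s f s (s (rev_ord k)))); last first.
  (* The transposition exchanges the vertices at [i] and [n - k - 1]. *)
  move=> i ik; rewrite (reindex_inj (mulgI (tperm i (rev_ord k)))) /=.
  apply: eq_bigr => s _; rewrite permM tpermL.
  rewrite (fk (tperm i (rev_ord k) * s)%g s)// => j jk.
  apply/finset.setP => v; rewrite !mem_last_vertices.
  rewrite invMg permM tpermV; move: ((s^-1)%g v) => w.
  by case: tpermP => [->|->|//] /=; have := ltn_ord k; lia.
rewrite sumr_const mulr_natl; congr (_ *+ _).
have := @big_ord_widen _ 0%N addn _ _ (fun=> 1%N) (leq_subr k n).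
rewrite sum1_card card_ord => {1}->; rewrite -sum1_card.
by apply: eq_bigl.
Qed.

(** The form in which conditional uniformity is used: the mean at time [k + 1] of
    a function of the past and of the present set is an average over the vertex
    that enters. *)
Lemma mean_last_verticesS k (f : 'S_n -> {set 'I_n} -> R) : (k < n)%N ->
  depends_on_last k f ->
  (n - k)%:R * mean (fun s => f s (last_vertices s k.+1)) =
  mean (fun s => \sum_(v in (~: last_vertices s k)%SET)
                    f s (v |: last_vertices s k)%SET).
Proof.
move=> kn fk.
rewrite -(@mean_next_vertex (Ordinal kn)
  (fun s v => f s (v |: last_vertices s k)%SET)).
  by congr (_ * _); apply: eq_mean => s; rewrite (last_verticesS s (Ordinal kn)).
by move=> s s' ss'; rewrite (fk s s')// ss'.
Qed.

End removed_vertices.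

(** * Holes, runs and fatal vertices *)

Section cycle_sets.
Import mathcomp.boot.fintype mathcomp.boot.finset.
Local Open Scope set_scope.
Local Open Scope nat_scope.
Variable n : nat.
Implicit Types (B : {set 'I_n}) (u v w : 'I_n).

Definition has_hole B :=
  [exists v, [&& v \notin B, ord_pred v \in B & ordS v \in B]].

Definition right_ends B := [set w in B | ordS w \notin B].

Definition runs B := #|right_ends B|.

Definition pairs (f : 'I_n -> 'I_n) B := #|[set w in B | f w \in B]|.

Lemma ordS_inj : injective (@ordS n).
Proof. exact: can_inj (@ordSK n). Qed.

Lemma ord_pred_inj : injective (@ord_pred n).
Proof. exact: can_inj (@ord_predK n). Qed.

Lemma val_iter_ordS j v : iter j (@ordS n) v = (v + j) %% n :> nat.
Proof.
elim: j => [|j IH]; first by rewrite addn0 modn_small.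
by rewrite iterS /= IH -addn1 modnDml addn1 addnS.
Qed.

(** Going [j] steps around the cycle only closes up if [n] divides [j].  With
    [j <= 2] this keeps the two neighbours of a vertex apart, and with [j = 4]
    it prevents a vertex from being at distance four from itself. *)
Lemma iter_ordS_neq j v : 0 < j < n -> iter j (@ordS n) v != v.
Proof.
move=> /andP[j0 jn]; rewrite -val_eqE /= val_iter_ordS.
have vn := ltn_ord v; have [lt|ge] := ltnP (v + j) n.
  by rewrite modn_small//; lia.
rewrite -(subnK ge) modnDr modn_small; lia.
Qed.

(** Each run has one right end and one left end: [B] and its preimage under
    [ordS] have equal size, hence so do the two differences. *)
Lemma card_left_ends B : #|[set w | (w \notin B) && (ordS w \in B)]| = runs B.
Proof.
have h1 := cardsID B (@ordS n @^-1: B).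
have h2 := cardsID (@ordS n @^-1: B) B.
rewrite setIC -[RHS](card_preimset B ordS_inj) -{}h1 in h2.
move/addnI : h2 => h2; rewrite /runs.
transitivity #|@ordS n @^-1: B :\: B|; first by apply: eq_card => w; rewrite !inE.
by rewrite -h2; apply: eq_card => w; rewrite !inE andbC.
Qed.

Lemma runs_pairs B : runs B + pairs (@ordS n) B = #|B|.
Proof.
rewrite -(cardsID (@ordS n @^-1: B) B) addnC /runs /pairs; congr addn.
  by apply: eq_card => w; rewrite !inE.
by apply: eq_card => w; rewrite !inE andbC.
Qed.

Lemma runs_le_card B : runs B <= #|B|.
Proof. by rewrite -(runs_pairs B) leq_addr. Qed.

(** The vertices whose arrival makes a hole of their left, resp. right,
    neighbour. *)
Definition right_fatal B := [set u | (ord_pred (ord_pred u) \in B) && (ord_pred u \notin B)].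
Definition left_fatal B := [set u | (ordS (ordS u) \in B) && (ordS u \notin B)].

Lemma card_right_fatal B : #|right_fatal B| = runs B.
Proof.
rewrite /runs -(card_preimset (right_ends B) (inj_comp ord_pred_inj ord_pred_inj)).
by apply: eq_card => u; rewrite !inE /= ord_predK.
Qed.

Lemma card_left_fatal B : #|left_fatal B| = runs B.
Proof.
rewrite -(card_left_ends B) -(card_preimset [set w | (w \notin B) && (ordS w \in B)] ordS_inj).
by apply: eq_card => u; rewrite !inE andbC.
Qed.

(** The only overlap comes from a vertex with members of [B] at distance two on
    either side, and these two members are at distance four. *)
Lemma card_right_fatalI B :
  #|right_fatal B :&: left_fatal B| <= pairs (iter 4 (@ordS n)) B.
Proof.
rewrite -(card_preimset _ (inj_comp ordS_inj ordS_inj)) /pairs.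
apply: subset_leq_card; apply/subsetP => w; rewrite !inE /= !ordSK.
by case/andP=> /andP[-> _] /andP[->].
Qed.

(** If [u] were in [B] already, [ord_pred u] would be a hole. *)
Lemma right_fatal_sub B : ~~ has_hole B -> right_fatal B \subset ~: B.
Proof.
move=> /existsPn h; apply/subsetP => u; rewrite !inE => /andP[p2 p1].
by have := h (ord_pred u); rewrite p1 p2 ord_predK.
Qed.

Lemma left_fatal_sub B : ~~ has_hole B -> left_fatal B \subset ~: B.
Proof.
move=> /existsPn h; apply/subsetP => u; rewrite !inE => /andP[p2 p1].
by have := h (ordS u); rewrite p1 p2 ordSK andbT.
Qed.

(** Without holes, every gap of [B] has at least two vertices: the first one and
    the right-fatal one that follows it. *)
Lemma runs_le_half B : ~~ has_hole B -> (runs B).*2 <= n - #|B|.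
Proof.
move=> hB; have e : #|right_fatal B :|: [set u | (u \notin B) && (ord_pred u \in B)]| = (runs B).*2.
  rewrite cardsU card_right_fatal.
  have -> : #|[set u | (u \notin B) && (ord_pred u \in B)]| = runs B.
    rewrite -(card_preimset _ ordS_inj) /runs.
    by apply: eq_card => u; rewrite !inE ordSK andbC.
  rewrite (_ : _ :&: _ = set0) ?cards0 ?subn0 ?addnn//.
  by apply/setP => u; rewrite !inE; case: (ord_pred u \in B); rewrite !andbF.
rewrite -e; have -> : n - #|B| = #|~: B| by rewrite [RHS]cardsCs setCK card_ord.
apply: subset_leq_card; rewrite subUset right_fatal_sub//=.
by apply/subsetP => u; rewrite !inE => /andP[].
Qed.

(** A new hole must have [u] as one of its two neighbours, and [u] itself cannot
    be filling a hole since there was none. *)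
Lemma has_holeU1 B u : 2 < n -> ~~ has_hole B -> u \notin B ->
  has_hole (u |: B) = (u \in right_fatal B :|: left_fatal B).
Proof.
move=> n3 /existsPn hB uB.
have S1 v : ordS v != v by apply: (@iter_ordS_neq 1); lia.
have S2 v : ordS (ordS v) != v by apply: (@iter_ordS_neq 2); lia.
have p1 : ord_pred u != u by have := S1 (ord_pred u); rewrite ord_predK eq_sym.
rewrite !inE; apply/existsP/orP.
- move=> [v]; rewrite !inE negb_or => /and3P[/andP[vu vB]].
  have := hB v; rewrite vB /=; case: eqVneq => [pv|_] /=; last first.
    move=> + vp; rewrite vp /= => /negbTE ->; rewrite orbF => /eqP sv.
    by left; rewrite -sv !ordSK vp vB.
  move=> _ _; rewrite -[v]ord_predK pv in vB *.
  by rewrite (negbTE (S2 u)) /= => s2; right; rewrite vB s2.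
- case=> /andP[i o].
    by exists (ord_pred u); rewrite !inE negb_or o p1 i orbT ord_predK eqxx.
  by exists (ordS u); rewrite !inE negb_or o S1 i orbT ordSK eqxx.
Qed.

End cycle_sets.

(** * One step of the reversed process *)

Section one_step.
Import mathcomp.boot.fintype mathcomp.boot.finset.
Local Open Scope set_scope.
Local Open Scope nat_scope.
Variable n : nat.
Implicit Types (B : {set 'I_n}) (u v w : 'I_n).

Lemma card_sum_mem (T : finType) (A : {set T}) : #|A| = \sum_x (x \in A).
Proof. by rewrite -sum1_card big_mkcond /=; apply: eq_bigr => x _; case: (x \in A). Qed.

(** Adding [u] creates at most two pairs, with [f u] and with the preimage of
    [u]; summed over [u], each member of [B] is counted once as [f u] and once as
    that preimage. *)
Lemma sum_pairsU1 (f : 'I_n -> 'I_n) B : injective f -> (forall w, f w != w) ->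
  \sum_(u in ~: B) pairs f (u |: B) <= (n - #|B|) * pairs f B + #|B|.*2.
Proof.
move=> f_inj f_neq.
have step u : pairs f (u |: B) <=
    pairs f B + ((f u \in B) + #|[set w in B | f w == u]|).
  rewrite /pairs (_ : (f u \in B) = #|[set w | (w == u) && (f u \in B)]| :> nat).
    apply: leq_trans (_ : #|[set w in B | f w \in B] :|:
       ([set w | (w == u) && (f u \in B)] :|: [set w in B | f w == u])| <= _).
      apply: subset_leq_card; apply/subsetP => w; rewrite !inE.
      case: (eqVneq w u) => [->|wu] /=.
        by rewrite (negbTE (f_neq u)) /= => ->; rewrite orbT.
      by move=> /andP[->] /orP[->|->]; rewrite ?orbT.
    by apply: leq_trans (leq_card_setU _ _) _; rewrite leq_add2l leq_card_setU.
  case: (f u \in B) => /=.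
    by rewrite -(cards1 u); apply: eq_card => w; rewrite !inE andbT.
  by rewrite -(cards0 'I_n); apply: eq_card => w; rewrite !inE andbF.
apply: leq_trans (leq_sum _ (fun u _ => step u)) _.
rewrite big_split /= sum_nat_const big_split /=.
have -> : n - #|B| = #|~: B| by rewrite [RHS]cardsCs setCK card_ord.
rewrite leq_add2l -addnn.
apply: leq_add.
  rewrite -[leqRHS](card_preimset _ f_inj) card_sum_mem big_mkcond /=.
  by apply: leq_sum => u _; rewrite !inE; case: ifP.
rewrite [leqRHS](_ : _ = \sum_u #|[set w in B | f w == u]|).
  by rewrite big_mkcond /=; apply: leq_sum => u _; case: ifP.
under eq_bigr do rewrite card_sum_mem.
rewrite exchange_big card_sum_mem /=; apply: eq_bigr => w _.
rewrite (bigD1 (f w))//= big1 ?addn0 => [|u uw]; first by rewrite !inE eqxx andbT.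
by rewrite !inE eq_sym (negbTE uw) andbF.
Qed.

Definition safe B := [set u in ~: B | ~~ has_hole (u |: B)].

Lemma safeE B : 2 < n -> ~~ has_hole B ->
  safe B = ~: B :\: (right_fatal B :|: left_fatal B).
Proof.
move=> n3 hB; apply/setP => u; rewrite /safe in_setD !in_set.
case: (boolP (u \in B)) => uB /=; rewrite ?andbF//.
by rewrite has_holeU1// !inE andbT.
Qed.

(** Inclusion-exclusion on the two kinds of fatal vertices, arranged so as to
    avoid truncated subtractions. *)
Lemma card_safe B : 2 < n -> ~~ has_hole B ->
  #|safe B| + (runs B).*2 + #|B| = n + #|right_fatal B :&: left_fatal B|.
Proof.
move=> n3 hB; rewrite safeE// cardsDS; last first.
  by rewrite subUset right_fatal_sub// left_fatal_sub.
have h1 := cardsUI (right_fatal B) (left_fatal B).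
have := cardsC B; rewrite card_ord => h2.
have : #|right_fatal B :|: left_fatal B| <= #|~: B|.
  by apply: subset_leq_card; rewrite subUset right_fatal_sub// left_fatal_sub.
move: h1 h2; rewrite card_right_fatal card_left_fatal.
move: #|_ :|: _| #|_ :&: _| #|~: B| #|B| (runs B) => a b c d e.
lia.
Qed.

Lemma card_safe_ge B : 2 < n -> ~~ has_hole B -> n <= #|safe B| + 3 * #|B|.
Proof. by move=> n3 hB; have := card_safe n3 hB; have := runs_le_card B; lia. Qed.

(** The number of runs is [#|B|] minus the number of adjacent pairs, so that
    runs and overlap together cost the pairs at distance one, twice, and the
    pairs at distance four. *)
Lemma card_safe_le B : 2 < n -> ~~ has_hole B ->
  #|safe B| + 3 * #|B| <=
  n + 2 * pairs (@ordS n) B + pairs (iter 4 (@ordS n)) B.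
Proof.
move=> n3 hB; have := card_safe n3 hB; have := runs_pairs B.
by have := card_right_fatalI B; lia.
Qed.

(** A vertex that touches no run opens a new one, and a vertex that touches a
    single run extends it.  A vertex touching two runs would fill a hole. *)
Lemma runsU1_ge B u : 1 < n -> ~~ has_hole B -> u \notin B ->
  runs B + 1 <= runs (u |: B) + (ord_pred u \in B) + (ordS u \in B).
Proof.
move=> n2 /existsPn hB uB; have := hB u; rewrite uB /= => hu.
set X := right_ends B :\ ord_pred u.
have sub w : w \in X -> w \in right_ends (u |: B).
  rewrite !inE negb_or => /and3P[wp -> ->]; rewrite orbT andbT /=.
  by apply: contra wp => /eqP <-; rewrite ordSK.
have -> : runs B = (ord_pred u \in B) + #|X|.
  by rewrite /runs (cardsD1 (ord_pred u)) !inE ord_predK uB andbT.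
have [sB|sB] := boolP (ordS u \in B).
  have : #|X| <= runs (u |: B) by apply: subset_leq_card; apply/subsetP.
  by move: hu; rewrite sB andbT => /negbTE ->; rewrite add0n addn0 leq_add2r.
have : #|u |: X| <= runs (u |: B).
  apply: subset_leq_card; apply/subsetP => w; rewrite in_setU1 => /orP[/eqP->|].
    by rewrite !inE eqxx /= negb_or sB andbT (iter_ordS_neq (j := 1)).
  exact: sub.
rewrite cardsU1 !inE (negbTE uB) (negbTE sB) !andbF /= addn0.
by move: #|X| (runs _) (ord_pred u \in B) => a b []; lia.
Qed.

End one_step.

Lemma ler_of_eq (R : numDomainType) (x y : R) : x = y -> x <= y.
Proof. by move=> ->. Qed.

Section one_step_sum.
Import mathcomp.boot.fintype mathcomp.boot.finset.
Variables (R : realFieldType) (n : nat) (B : {set 'I_n}) (y : R).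

(** The choices of [u] are discounted by [y] when they open a run, not at all
    when they extend one ([2 * runs B] choices at most), and disappear when they
    are fatal (at least [runs B] choices, counting the right-fatal ones only).
    The coefficient [2 - 3 y] is what remains of the last two effects; it is
    negative as soon as [y > 2/3]. *)
Lemma sum_safe_expr_runs : (2 < n)%N -> ~~ has_hole B -> 0 <= y <= 1 ->
  \sum_(u in ~: B) (~~ has_hole (u |: B))%:R * y ^+ runs (u |: B) <=
  y ^+ runs B * (y * (n%:R - #|B|%:R) + (2 - 3 * y) * (runs B)%:R).
Proof.
move=> n3 hB /andP[y0 y1].
have n2 : (1 < n)%N by exact: ltnW.
have step u : u \notin B ->
    (~~ has_hole (u |: B))%:R * y ^+ runs (u |: B) <=
    y ^+ runs B * ((u \notin right_fatal B)%:R *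
      (y + (1 - y) * ((ord_pred u \in B)%:R + (ordS u \in B)%:R))).
  move=> uB; rewrite has_holeU1// in_setU negb_or.
  case: (u \notin right_fatal B) => /=; last by rewrite !mul0r mulr0.
  rewrite mul1r (@le_trans _ _ (y ^+ runs (u |: B)))//.
    by rewrite ler_piMl ?exprn_ge0//; case: (u \notin _).
  have := runsU1_ge n2 hB uB; move: hB => /existsPn/(_ u); rewrite uB /=.
  move: (runs _) (runs B) => a b.
  case: (ord_pred u \in B); case: (ordS u \in B) => //= _ le.
  - rewrite addr0 mulr1 addrC subrK mulr1.
    by apply: ler_wiXn2l => //; lia.
  - rewrite add0r mulr1 addrC subrK mulr1.
    by apply: ler_wiXn2l => //; lia.
  - rewrite addr0 mulr0 addr0 -exprSr.
    by apply: ler_wiXn2l => //; lia.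
have sumE (P : pred 'I_n) : \sum_(u in ~: B) (P u)%:R =
    #|[set u in ~: B | P u]|%:R :> R.
  rewrite -sum1_card natr_sum big_mkcond [RHS]big_mkcond /=.
  by apply: eq_bigr => u _; rewrite !inE; case: (u \in _); case: (P u).
have cD1 : #|[set u in ~: B | u \in right_fatal B]| = runs B.
  rewrite -(card_right_fatal B); apply: eq_card => u; rewrite in_set andb_idl//.
  by move=> uD; apply: (subsetP (right_fatal_sub hB)).
have cp : #|[set u in ~: B | ord_pred u \in B]| = runs B.
  rewrite -(card_preimset _ (@ordS_inj n)) /runs.
  by apply: eq_card => u; rewrite !inE ordSK andbC.
have cs : #|[set u in ~: B | ordS u \in B]| = runs B.
  by rewrite -(card_left_ends B); apply: eq_card => u; rewrite !inE.
have cB : #|~: B|%:R = n%:R - #|B|%:R :> R.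
  by apply/eqP; rewrite eq_sym subr_eq -natrD addnC cardsC card_ord.
apply: (@le_trans _ _ (\sum_(u in ~: B) (y ^+ runs B * (y - y * (u \in right_fatal B)%:R
    + (1 - y) * ((ord_pred u \in B)%:R + (ordS u \in B)%:R))))).
  apply: ler_sum => u; rewrite in_setC => uB; apply: le_trans (step u uB) _.
  rewrite ler_wpM2l ?exprn_ge0//; case: (u \in right_fatal B) => /=.
    by rewrite mul0r mulr1 subrr add0r mulr_ge0// ?subr_ge0// addr_ge0.
  by rewrite mul1r mulr0 subr0.
rewrite -mulr_sumr ler_wpM2l ?exprn_ge0// 2!big_split /= sumr_const -(mulr_natr y).
rewrite sumrN -!mulr_sumr big_split /= !sumE cD1 cp cs cB.
by apply: ler_of_eq; ring.
Qed.

End one_step_sum.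

(** * The survival function *)

Lemma bernoulli_ineq (R : realFieldType) (e : R) m : e <= 1 ->
  1 - m%:R * e <= (1 - e) ^+ m.
Proof.
move=> e1; elim: m => [|m IH]; first by rewrite mul0r subr0 expr0.
rewrite exprS; apply: (@le_trans _ _ ((1 - e) * (1 - m%:R * e))).
  rewrite -natr1 -subr_ge0 (_ : _ - _ = m%:R * e ^+ 2); last by ring.
  by rewrite mulr_ge0// sqr_ge0.
by rewrite ler_wpM2l// subr_ge0.
Qed.

Section survival.
Import mathcomp.boot.fintype mathcomp.boot.finset.
Variable n : nat.
Implicit Types (s : 'S_n) (k : nat).

Definition survives s k :=
  all (fun j => ~~ has_hole (last_vertices s j)) (iota 0 k.+1).

Lemma survivesS s k :
  survives s k.+1 = survives s k && ~~ has_hole (last_vertices s k.+1).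
Proof. by rewrite /survives -addn1 iotaD all_cat /= andbT add0n. Qed.

Lemma survives_no_hole s k : survives s k -> ~~ has_hole (last_vertices s k).
Proof. by move/allP; apply; rewrite mem_iota; lia. Qed.

Lemma survives_depends k : depends_on_last k (fun s => survives s k).
Proof.
by move=> s s' ss'; apply: eq_in_all => j; rewrite mem_iota => jk; rewrite ss'//; lia.
Qed.

Lemma exists_isolated s t :
  [exists v, Defs.isolated (@cycle_adj n) (first_vertices s t) v] =
  has_hole (~: first_vertices s t).
Proof.
apply: eq_existsb => v; rewrite /Defs.isolated !in_setC negbK; congr (_ && _).
apply/forallP/andP => [h|[hp hs] u].
  by have := (h (ord_pred v), h (ordS v)); rewrite /cycle_adj !eqxx orbT !implybF => -[].
by apply/implyP => uA; apply/norP; split; apply: contraTneq uA => ->.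
Qed.

(** The last isolated time is before [n - k] iff all later times, that is all
    [B_j] with [j <= k], are without holes. *)
Lemma isolation_gap_gt s k : (k < n)%N -> (k < isolation_gap s)%N = survives s k.
Proof.
move=> kn; rewrite /isolation_gap /last_isolated_time.
have -> : forall m, (k < n - m)%N = (m < n - k)%N by lia.
apply/idP/allP => [lt j|h].
  rewrite mem_iota => /= jk; apply/negP => hj; move: lt; rewrite ltnNge => /negP; apply.
  have nj : (n - j < n.+1)%N by rewrite ltnS leq_subr.
  apply: leq_trans (_ : n - j <= _)%N; first lia.
  by apply: (bigop.bigmax_sup (Ordinal nj)); rewrite /= ?exists_isolated.
rewrite -[X in (_ < X)%N]prednK ?ltnS; last lia.
apply/bigmax_leqP => t; rewrite exists_isolated => ht.
rewrite -ltnS prednK; last lia.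
rewrite ltnNge; apply/negP => le.
have := h (n - t)%N; rewrite mem_iota /last_vertices subKn; last by rewrite -ltnS.
by rewrite ht => /(_ _)/negP; apply => //; have := ltn_ord t; lia.
Qed.

Lemma isolation_gap_le s : (isolation_gap s <= n)%N.
Proof. exact: leq_subr. Qed.

Variable R : realFieldType.

Definition survival k : R := mean (fun s => (k < isolation_gap s)%:R).

Lemma survivalE k : (k < n)%N -> survival k = mean (fun s => (survives s k)%:R).
Proof. by move=> kn; apply: eq_mean => s; rewrite isolation_gap_gt. Qed.

Lemma survival_ge0 k : 0 <= survival k.
Proof. exact: mean_ge0. Qed.

Lemma survival_eq0 k : (n <= k)%N -> survival k = 0.
Proof.
move=> nk; rewrite -[RHS](mean_cst n); apply: eq_mean => s.
by rewrite ltnNge (leq_trans (isolation_gap_le s) nk).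
Qed.

Lemma le_survival j k : (j <= k)%N -> survival k <= survival j.
Proof.
move=> jk; apply: le_mean => s; rewrite ler_nat.
by case: ltnP => // /(leq_ltn_trans jk) ->.
Qed.

Lemma survival0 : (0 < n)%N -> survival 0 = 1.
Proof.
move=> n0; rewrite survivalE// -[RHS](mean_cst n); apply: eq_mean => s.
rewrite /survives /= last_vertices0 andbT.
rewrite (_ : has_hole _ = false)//; apply/existsP => -[v].
by rewrite !inE.
Qed.

(** Conditionally on survival up to time [k], the process survives one more step
    iff the new vertex is safe. *)
Lemma survivalS k : (2 < n)%N -> (k.+1 < n)%N ->
  (n - k)%:R * survival k.+1 =
  mean (fun s => (survives s k)%:R * #|safe (last_vertices s k)|%:R).
Proof.
move=> n3 kn; rewrite survivalE//.
have -> : mean (fun s => (survives s k.+1)%:R) = mean (fun s =>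
   (survives s k)%:R * (~~ has_hole (last_vertices s k.+1))%:R) :> R.
  by apply: eq_mean => s; rewrite survivesS -natrM mulnb.
rewrite (@mean_last_verticesS _ _ _
  (fun s B => (survives s k)%:R * (~~ has_hole B)%:R)) 1?ltnW//.
  apply: eq_mean => s; rewrite -mulr_sumr; congr (_ * _).
  rewrite card_sum_mem natr_sum big_mkcond /=; apply: eq_bigr => v _.
  by rewrite !inE; case: (v \in _).
by move=> s s' ss'; rewrite (survives_depends ss').
Qed.

Lemma survivalS_ge k : (2 < n)%N -> (k.+1 < n)%N ->
  (n%:R - 3 * k%:R) * survival k <= (n%:R - k%:R) * survival k.+1.
Proof.
move=> n3 kn; rewrite -natrB 1?ltnW 1?ltnW// survivalS// survivalE 1?ltnW//.
rewrite -meanZ; apply: le_mean => s; rewrite [leLHS]mulrC.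
case: (boolP (survives s k)) => [/survives_no_hole hs|]; last by rewrite !mul0r.
rewrite !mul1r lerBlDr -natrM -natrD ler_nat.
by have := card_safe_ge n3 hs; rewrite card_last_vertices// 2?ltnW.
Qed.

Definition mean_pairs f k : R := mean (fun s => (pairs f (last_vertices s k))%:R).

(** The defect is averaged over all orderings rather than over the surviving ones,
    which bounds it from above and decouples it from survival. *)
Lemma survivalS_le k : (2 < n)%N -> (k.+1 < n)%N -> (3 * k <= n)%N ->
  (n%:R - k%:R) * survival k.+1 <= (n%:R - 3 * k%:R) * survival k +
    (2 * mean_pairs (@ordS n) k + mean_pairs (iter 4 (@ordS n)) k).
Proof.
move=> n3 kn k3; rewrite -natrB 1?ltnW 1?ltnW// survivalS// survivalE 1?ltnW//.
rewrite -!meanZ -!meanD; apply: le_mean => s; rewrite [_ * (survives _ _)%:R]mulrC.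
case: (boolP (survives s k)) => [/survives_no_hole hs|]; last first.
  by rewrite !mul0r add0r addr_ge0// mulr_ge0.
rewrite !mul1r -[3 * _]natrM -natrB// -natrM -!natrD ler_nat.
have := card_safe_le n3 hs; rewrite card_last_vertices; last by lia.
move: #|_| (pairs _ _) (pairs _ _) => a b c; lia.
Qed.

(** A new vertex makes at most [2 k / (n - k)] pairs on average. *)
Lemma mean_pairs_le f k : injective f -> (forall w : 'I_n, f w != w) ->
  (0 < n)%N -> (2 * k <= n)%N -> mean_pairs f k <= 2 * k%:R ^+ 2 / n%:R.
Proof.
move=> fi fn n0; elim: k => [_|k IH kn].
  rewrite /mean_pairs expr0n mulr0 mul0r -[leRHS](mean_cst n); apply: le_mean => s.
  rewrite last_vertices0 /pairs (_ : [set w in _ | _] = set0) ?cards0//.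
  by apply/setP => w; rewrite !inE.
have kn' : (k < n)%N by lia.
have : (n - k)%:R * mean_pairs f k.+1 <= (n - k)%:R * mean_pairs f k + 2 * k%:R.
  rewrite (@mean_last_verticesS _ _ _ (fun s B => (pairs f B)%:R))// -meanZ.
  rewrite -[2 * _](mean_cst n) -meanD; apply: le_mean => s.
  rewrite -natr_sum -!natrM -natrD ler_nat.
  have := sum_pairsU1 (last_vertices s k) fi fn.
  by rewrite (card_last_vertices s (ltnW kn')) mul2n.
have {}IH := IH ltac:(lia).
have : (n - k)%:R >= n%:R / 2 :> R.
  rewrite ler_pdivrMr// -natrM ler_nat; lia.
have : 0 < n%:R :> R by rewrite ltr0n.
move: IH; rewrite -[k.+1%:R]natr1.
move: (mean_pairs f k) (mean_pairs f k.+1) (n%:R : R) (k%:R : R) (ler0n R k) ((n - k)%:R : R) => a b N K K0 M.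
move=> aK N0 MN H.
have M0 : 0 < M by apply: lt_le_trans MN; rewrite divr_gt0.
have {}H : b <= a + 2 * K / M.
  by rewrite -lerBlDl ler_pdivlMr// mulrBl lerBlDl ![_ * M]mulrC.
have : 2 * K / M <= 4 * K / N.
  rewrite ler_pdivrMr// mulrAC ler_pdivlMr//.
  move: MN; rewrite ler_pdivrMr// => MN.
  have h : 0 <= 2 * K * (M * 2 - N) by rewrite !mulr_ge0// subr_ge0.
  by rewrite -subr_ge0; apply: le_trans h _; apply: ler_of_eq; ring.
have -> : 2 * (K + 1) ^+ 2 / N = 2 * K ^+ 2 / N + 4 * K / N + 2 / N by field; lra.
have : 0 <= 2 / N by rewrite divr_ge0//; lra.
lra.
Qed.

Definition weighted_survival (y : R) k : R :=
  mean (fun s => (survives s k)%:R * y ^+ runs (last_vertices s k)).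

(** In the bound of [sum_safe_expr_runs], [2 - 3 y <= - y / 2] once
    [y >= 4 / 5]: a step costs a factor [y] for opening a run, and a factor
    [1 - m / (2 n)] when there are [m] runs.  By Bernoulli's inequality the
    latter is absorbed in a smaller weight per run. *)
Lemma weighted_survivalS y k : (2 < n)%N -> (k < n)%N -> 4 / 5 <= y <= 1 ->
  weighted_survival y k.+1 <=
  y * weighted_survival (y * (1 - (2 * n%:R)^-1)) k.
Proof.
move=> n3 kn /andP[y45 y1].
have y0 : 0 <= y by lra.
have N0 : 0 < n%:R :> R by rewrite ltr0n; lia.
set e := (2 * n%:R)^-1; have e0 : 0 < e by rewrite invr_gt0 mulr_gt0.
have M0 : 0 < (n - k)%:R :> R by rewrite ltr0n; lia.
rewrite -(ler_pM2l M0) /weighted_survival.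
have -> : mean (fun s => (survives s k.+1)%:R * y ^+ runs (last_vertices s k.+1)) =
   mean (fun s => (survives s k)%:R * ((~~ has_hole (last_vertices s k.+1))%:R *
      y ^+ runs (last_vertices s k.+1))) :> R.
  by apply: eq_mean => s; rewrite survivesS -mulnb natrM mulrA.
rewrite (@mean_last_verticesS _ _ _ (fun s B => (survives s k)%:R *
   ((~~ has_hole B)%:R * y ^+ runs B)))//; last first.
  by move=> s s' ss'; rewrite (survives_depends ss').
rewrite -!meanZ; apply: le_mean => s; rewrite -mulr_sumr.
case: (boolP (survives s k)) => [/survives_no_hole hs|]; last by rewrite !mul0r !mulr0.
rewrite !mul1r; apply: le_trans (sum_safe_expr_runs n3 hs _) _; first by rewrite y0.
rewrite (card_last_vertices s (ltnW kn)) -(natrB _ (ltnW kn)) exprMn.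
have e1 : e <= 1 by rewrite invf_le1 ?mulr_gt0// -natrM ler1n; lia.
have := bernoulli_ineq (runs (last_vertices s k)) e1.
have : (n - k)%:R * e <= 2^-1.
  rewrite /e invfM mulrCA ler_piMr// ler_pdivrMr// mul1r ler_nat; lia.
move: (runs _) => m Me bern.
have ym : 0 <= y ^+ m by rewrite exprn_ge0.
apply: (@le_trans _ _ (y ^+ m * (y * ((n - k)%:R * (1 - m%:R * e))))).
  rewrite ler_wpM2l//.
  have h1 : 0 <= y * m%:R * (2^-1 - (n - k)%:R * e).
    by rewrite !mulr_ge0// subr_ge0.
  have h2 : 0 <= m%:R * (5 / 2 * y - 2) by rewrite mulr_ge0//; lra.
  rewrite -subr_ge0; apply: le_trans (addr_ge0 h1 h2) _.
  by apply: ler_of_eq; field.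
rewrite [leRHS](_ : _ = y ^+ m * (y * ((n - k)%:R * (1 - e) ^+ m))); last by ring.
by rewrite ler_wpM2l// ler_wpM2l// ler_wpM2l// ltW.
Qed.

End survival.

(** * Bounds on the survival function *)

Section survival_bounds.
Variables (R : realType) (n : nat).
Implicit Types k : nat.

(** The exponent dominates the sum of [2 j / (n - 3 k)] over [j < k], and the
    factor [(n - 3 j) / (n - j)] is at least [exp(- 2 j / (n - 3 j))]. *)
Lemma survival_lower_bound k : (2 < n)%N -> (3 * k < n)%N ->
  expR (- (k%:R ^+ 2 / (n%:R - 3 * k%:R))) <= survival n R k.
Proof.
move=> n3 kn; set D : R := n%:R - 3 * k%:R.
have D0 : 0 < D by rewrite subr_gt0 -natrM ltr_nat.
suff h j : (j <= k)%N -> expR (- (j%:R ^+ 2 / D)) <= survival n R j by exact: h.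
elim: j => [_|j IH jk].
  by rewrite survival0 ?expr0n ?mul0r ?oppr0 ?expR0//; lia.
have {}IH := IH (ltnW jk).
have jn : (j.+1 < n)%N by lia.
have := survivalS_ge R n3 jn.
have J : D <= n%:R - 3 * j%:R by rewrite lerD2l lerN2 -!natrM ler_nat leq_mul2l ltnW.
have M0 : 0 < n%:R - j%:R :> R by rewrite subr_gt0 ltr_nat; lia.
have J0 : 0 < n%:R - 3 * j%:R :> R by exact: lt_le_trans J.
have h : (n%:R - j%:R) * expR (- (2 * j%:R / D)) <= n%:R - 3 * j%:R :> R.
  rewrite expRN ler_pdivrMr ?expR_gt0//.
  apply: (@le_trans _ _ ((n%:R - 3 * j%:R) * (1 + 2 * j%:R / D))).
    rewrite mulrDr mulr1 -lerBlDl.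
    apply: (@le_trans _ _ (D * (2 * j%:R / D))).
      by rewrite [leRHS]mulrC divfK ?gt_eqF//; apply: ler_of_eq; ring.
    by rewrite ler_wpM2r// divr_ge0// ?mulr_ge0// ltW.
  by rewrite ler_wpM2l ?expR_ge1Dx// ltW.
move=> H; rewrite -(ler_pM2l M0); apply: le_trans H.
apply: (@le_trans _ _ ((n%:R - j%:R) * expR (- (2 * j%:R / D)) * expR (- (j%:R ^+ 2 / D)))).
  rewrite -mulrA -expRD ler_wpM2l ?ler_expR ?(ltW M0)//.
  rewrite -opprD lerN2 -mulrDl ler_wpM2r ?invr_ge0 ?(ltW D0)//.
  by rewrite -[j.+1%:R]natr1 sqrrD mulr1 addrC mulr_natl lerDl expr1n.
by rewrite ler_pM// ?mulr_ge0 ?expR_ge0// ltW.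
Qed.

(** The first term bounds the product of the [1 - 2 j / n], the second one
    accumulates the contribution [12 j^2 / n^2] of the mean defect at each step. *)
Lemma survival_upper_bound k : (5 <= n)%N -> (3 * k <= n)%N ->
  survival n R k <=
  expR (- (k%:R * (k%:R - 1) / n%:R)) + 12 * k%:R ^+ 3 / n%:R ^+ 2.
Proof.
move=> n5; have N0 : 0 < n%:R :> R by rewrite ltr0n; lia.
elim: k => [_|k IH k3].
  by rewrite survival0 ?mul0r ?oppr0 ?expR0 ?expr0n ?mulr0 ?mul0r ?addr0//; lia.
have {}IH := IH ltac:(lia).
have kn : (k.+1 < n)%N by lia.
have := survivalS_le R (leq_trans (_ : 2 < 5)%N n5) kn ltac:(lia).
move=> /(_ isT).
have S1 (w : 'I_n) : ordS w != w by apply: (iter_ordS_neq (j := 1)); lia.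
have S4 (w : 'I_n) : iter 4 (@ordS n) w != w by apply: iter_ordS_neq; lia.
have i4 : injective (iter 4 (@ordS n)) by do 3!apply: inj_comp (@ordS_inj n) _; exact: ordS_inj.
have k2 : (2 * k <= n)%N by lia.
have := mean_pairs_le R (@ordS_inj n) S1 ltac:(lia) k2.
have := mean_pairs_le R i4 S4 ltac:(lia) k2.
have K3 : 3 * k%:R + 3 <= n%:R :> R by rewrite -natrM -natrD ler_nat; lia.
have K0 : 0 <= k%:R :> R by [].
move: IH; rewrite -[k.+1%:R]natr1 addrK; set E := expR _; set E' := expR _.
have hE : (1 - 2 * k%:R / n%:R) * E <= E'.
  apply: (@le_trans _ _ (expR (- (2 * k%:R / n%:R)) * E)).
    by rewrite ler_wpM2r ?expR_ge0// expR_ge1Dx.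
  rewrite -expRD ler_expR; apply: ler_of_eq; field.
  by rewrite gt_eqF.
have : 0 <= survival n R k by exact: survival_ge0.
move: hE N0 K3 K0; move: (survival _ _ _) (survival _ _ _).
move: (mean_pairs _ _ _) (mean_pairs _ _ _) E E' (n%:R : R) (k%:R : R).
move=> a b E E' N K q' q hE N0 K3 K0 q0 qE ha hb H.
have M0 : 0 < N - K by lra.
have r0 : 0 <= 1 - 2 * K / N by rewrite subr_ge0 ler_pdivrMr//; lra.
have step : q' <= (1 - 2 * K / N) * q + 12 * K ^+ 2 / N ^+ 2.
  rewrite -(ler_pM2l M0); apply: le_trans H _.
  apply: (@le_trans _ _ ((N - 3 * K) * q + 6 * K ^+ 2 / N)); first by lra.
  rewrite -subr_ge0 (_ : _ - _ = 2 * K ^+ 2 / N * q + 6 * K ^+ 2 * (N - 2 * K) / N ^+ 2).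
    by rewrite addr_ge0// ?mulr_ge0// ?invr_ge0 ?exprn_ge0 ?subr_ge0//; lra.
  by field; rewrite gt_eqF.
apply: le_trans step _.
apply: (@le_trans _ _ ((1 - 2 * K / N) * (E + 12 * K ^+ 3 / N ^+ 2) + 12 * K ^+ 2 / N ^+ 2)).
  by rewrite lerD2r ler_wpM2l.
rewrite mulrDr -addrA lerD//.
rewrite -subr_ge0 (_ : _ - _ = 24 * K ^+ 4 / N ^+ 3 + 12 * (2 * K ^+ 2 + 3 * K + 1) / N ^+ 2).
  by rewrite addr_ge0// ?mulr_ge0 ?invr_ge0 ?exprn_ge0 ?addr_ge0 ?mulr_ge0 ?exprn_ge0// ltW.
by field; rewrite gt_eqF.
Qed.

(** Going back in time, [weighted_survivalS] multiplies the weight by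
    [1 - 1 / (2 n)] at each step and pulls out the current weight as a factor;
    the exponents [i, i + 1, ..., i + k - 1] add up. *)
Lemma weighted_survival_le k i : (2 < n)%N -> (5 * (k + i) <= 2 * n)%N ->
  weighted_survival n ((1 - (2 * n%:R)^-1) ^+ i : R) k <=
  (1 - (2 * n%:R)^-1) ^+ (i * k + 'C(k, 2)).
Proof.
move=> n3; set e : R := (2 * n%:R)^-1.
have N0 : 0 < n%:R :> R by rewrite ltr0n; lia.
have e0 : 0 < e by rewrite invr_gt0 mulr_gt0.
have e1 : e <= 1 by rewrite invf_le1 ?mulr_gt0// -natrM ler1n; lia.
elim: k i => [|k IH] i kin.
  rewrite muln0 expr0 -[leRHS](mean_cst n); apply: le_mean => s.
  rewrite last_vertices0 (_ : runs _ = 0%N) ?expr0 ?mulr1 ?lern1 ?leq_b1//.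
  by apply/eqP; rewrite -leqn0 -(cards0 'I_n) runs_le_card.
have ei : 4 / 5 <= (1 - e) ^+ i <= 1.
  rewrite exprn_ile1 ?andbT; [|lra|lra].
  apply: le_trans (bernoulli_ineq i e1).
  rewrite lerBrDl -lerBrDr /e ler_pdivrMr ?mulr_gt0//.
  have : 5 * i%:R <= 2 * n%:R :> R by rewrite -!natrM ler_nat; lia.
  by lra.
apply: le_trans (weighted_survivalS n3 _ ei) _; first lia.
rewrite -exprSr (le_trans (ler_wpM2l _ (IH i.+1 _)))//; [|lia|].
  by rewrite exprn_ge0//; lra.
by rewrite -exprD binS bin1; apply: ler_wiXn2l; [lra|lra|lia].
Qed.

(** Survival is weighted survival with weight [1]; the condition on [k] keeps all
    the weights met on the way above [4 / 5]. *)
Lemma survival_tail_nat k : (2 < n)%N -> (5 * k <= 2 * n)%N ->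
  survival n R k <= expR (- (k%:R * (k%:R - 1) / (4 * n%:R))).
Proof.
move=> n3 kn; have N0 : 0 < n%:R :> R by rewrite ltr0n; lia.
have : survival n R k <= weighted_survival n (1 : R) k.
  rewrite survivalE; last lia.
  by apply: le_mean => s; rewrite expr1n mulr1.
move=> /le_trans; apply.
have := @weighted_survival_le k 0 n3; rewrite addn0 expr0 => /(_ kn) /le_trans; apply.
rewrite mul0n add0n; set e : R := (2 * n%:R)^-1.
apply: (@le_trans _ _ (expR (- e) ^+ 'C(k, 2))).
  apply: lerXn2r; rewrite ?nnegrE ?expR_ge0//; last exact: expR_ge1Dx.
  by rewrite subr_ge0 invf_le1 ?mulr_gt0// -natrM ler1n; lia.
rewrite -expRM_natl ler_expR mulrN lerN2 /e.
have -> : 'C(k, 2)%:R = k%:R * (k%:R - 1) / 2 :> R.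
  case: k kn => [_|k _]; first by rewrite !mul0r.
  have : (2 * 'C(k.+1, 2) = k.+1 * k)%N by rewrite bin2 mul2n even_halfK // oddM /= andNb.
  move/(congr1 (fun m => m%:R : R)); rewrite !natrM -[k.+1%:R]natr1 addrK; lra.
by apply: ler_of_eq; field; rewrite gt_eqF.
Qed.

End survival_bounds.

(** * The Gamma function as a tail integral *)

Section gamma_layer_cake.
Variable R : realType.
Local Notation mu := (@lebesgue_measure R).

Lemma measurable_expR_opp (b : R) (D : set R) :
  measurable_fun D (fun y : R => (expR (- (b * y)))%:E).
Proof.
apply/measurable_EFinP; apply: measurable_funTS; apply: measurableT_comp => //.
by apply: measurableT_comp => //; exact: measurable_funM.
Qed.

Lemma integral_expR_tail (b a : R) : 0 < b ->
  (\int[mu]_(y in `]a, +oo[) (expR (- (b * y)))%:E)%E = (expR (- (b * a)) / b)%:E.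
Proof.
move=> b0; have cN : continuous (fun y : R => expR (- (b * y))).
  move=> y; apply: continuous_comp; last exact: continuous_expR.
  by apply: continuousN; apply: continuousM; [exact: cst_continuous|exact: cvg_id].
rewrite integral_itv_obnd_cbnd; last first.
  apply/measurable_EFinP; apply: measurable_funTS.
  exact: continuous_measurable_fun.
rewrite (@ge0_continuous_FTC2y _ _ (fun y => - (expR (- (b * y)) / b)) a 0)//.
- by rewrite EFinN oppeK add0e.
- exact: continuous_subspaceT.
- rewrite -oppr0 -(mul0r b^-1); apply: cvgN; apply: cvgM; last exact: cvg_cst.
  apply: (@cvg_comp _ _ _ (fun z => b * z) (fun z => expR (- z)) _ (pinfty_nbhs R)).
    exact: gt0_cvgMry.
  exact: cvgr_expR.
- apply: cvgN; apply: cvgM; last exact: cvg_cst.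
  by apply/cvg_at_right_filter; exact: cN.
- move=> x _; rewrite derive1E derive_val /=.
  by rewrite /GRing.scale /=; field; rewrite gt_eqF.
Qed.

Lemma ltr_powRV (s a b : R) : 0 < s -> 0 <= a -> 0 <= b ->
  (a `^ s^-1 < b) = (a < b `^ s).
Proof.
move=> s0 a0 b0; have si0 : 0 < s^-1 by rewrite invr_gt0.
apply/idP/idP => h.
  have := @gt0_ltr_powR R s s0 _ _ _ _ h; rewrite !nnegrE powR_ge0 b0.
  by rewrite -powRrM mulVf ?gt_eqF// powRr1//; exact.
have := @gt0_ltr_powR R s^-1 si0 _ _ _ _ h; rewrite !nnegrE powR_ge0 a0.
by rewrite -powRrM mulfV ?gt_eqF// powRr1//; exact.
Qed.

(** Both sides are the integral of [expR (- y)] over the pairs with [t >= 0] and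
    [y > c * t `^ s^-1], that is [t < (y / c) `^ s]. *)
Lemma integral_expR_powR (s c : R) : 0 < s -> 0 < c ->
  (\int[mu]_(t in `[0%R, +oo[) (expR (- (c * t `^ s^-1)))%:E =
   \int[mu]_(y in `]0%R, +oo[) ((y / c) `^ s * expR (- y))%:E)%E.
Proof.
move=> s0 c0.
(* [GR] is the line with its Borel sets. *)
pose GR := measurableTypeR R.
pose A : set (GR * GR) := [set p | 0 <= p.1 /\ c * p.1 `^ s^-1 < p.2].
have mA : measurable A.
  rewrite (_ : A = ((fun p : GR * GR => 0 <= p.1) @^-1` [set true]) `&`
      ((fun p : GR * GR => c * p.1 `^ s^-1 < p.2) @^-1` [set true])); last first.
    by apply/seteqP; split => p.
  apply: measurableI.
    have : measurable_fun setT (fun p : GR * GR => 0 <= p.1) by exact: measurable_fun_ler.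
    by move=> /(_ measurableT [set true]); rewrite setTI; exact.
  have : measurable_fun setT (fun p : GR * GR => c * p.1 `^ s^-1 < p.2).
    apply: measurable_fun_ltr => //; apply: measurable_funM => //.
    exact: (measurableT_comp (measurable_powR _)).
  by move=> /(_ measurableT [set true]); rewrite setTI; exact.
pose F (p : GR * GR) : \bar R := (\1_A p * expR (- p.2))%:E.
have mF : measurable_fun setT F.
  apply/measurable_EFinP; apply: measurable_funM => //.
  by apply: measurableT_comp => //; exact: measurableT_comp.
have F0 p : (0 <= F p)%E by rewrite lee_fin mulr_ge0 ?expR_ge0.
transitivity (\int[mu]_t \int[mu]_y F (t, y))%E.
  rewrite integral_mkcond; apply: eq_integral => t _.
  rewrite patchE; case: ifPn => t0; last first.
    rewrite integral0_eq// => y _; rewrite /F indicE memNset ?mul0r// => -[/= h _].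
    by move/negP: t0; apply; rewrite inE/= in_itv/= h.
  have {}t0 : 0 <= t by move: t0; rewrite inE/= in_itv/= andbT.
  have := @integral_expR_tail 1 (c * t `^ s^-1) ltr01.
  rewrite mul1r divr1 => <-; rewrite integral_mkcond; apply: eq_integral => y _.
  rewrite patchE /F indicE; case: ifPn => y0.
    by rewrite mul1r mem_set ?mul1r//; split=> //=; move: y0; rewrite inE/= in_itv/= andbT.
  rewrite memNset ?mul0r// => -[_ /= h].
  by move/negP: y0; apply; rewrite inE/= in_itv/= h.
rewrite (fubini_tonelli F)//.
rewrite [RHS]integral_mkcond; apply: eq_integral => y _ /=.
rewrite patchE; case: ifPn => y0; last first.
  rewrite integral0_eq// => t _; rewrite /F indicE memNset ?mul0r// => -[/= t0 h].
  move/negP: y0; apply; rewrite inE/= in_itv/= andbT.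
  by apply: le_lt_trans h; rewrite mulr_ge0 ?powR_ge0// ltW.
have {}y0 : 0 < y by move: y0; rewrite inE/= in_itv/= andbT.
transitivity (\int[mu]_(t in `[0%R, ((y / c) `^ s)%R[) (expR (- y))%:E)%E; last first.
  by rewrite integral_cst//= lebesgue_measure_itv/= lte_fin powR_gt0 ?divr_gt0//
    sube0 -EFinM mulrC.
rewrite [RHS]integral_mkcond; apply: eq_integral => t _.
rewrite patchE /F indicE; case: ifPn => ht.
  move: ht; rewrite inE/= in_itv/= => /andP[t0 ht]; rewrite mem_set ?mul1r//; split => //=.
  by rewrite mulrC -ltr_pdivlMr// ltr_powRV// divr_ge0// ltW.
rewrite memNset ?mul0r// => -[/= t0 h]; move/negP: ht; apply.
rewrite inE/= in_itv/= t0 /=.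
by rewrite -ltr_powRV// ?divr_ge0 ?(ltW y0) ?(ltW c0)// ltr_pdivlMr// mulrC.
Qed.

Lemma measurable_powR_expR (s c : R) (D : set R) :
  measurable_fun D (fun y : R => ((y / c) `^ s * expR (- y))%:E).
Proof.
apply/measurable_EFinP; apply: measurable_funTS; apply: measurable_funM.
  apply: (measurableT_comp (measurable_powR _)).
  exact: measurable_funM.
by apply: measurableT_comp => //; exact: measurableT_comp.
Qed.

(** Half of the exponential pays for the power: [y / (2 s) <= expR (y / (2 s))],
    raised to the power [s].  Finiteness matters twice: [Gamma] is a real-valued
    integral, and dominated convergence needs an integrable majorant. *)
Lemma integral_powR_expR_lty (s c : R) : 0 < s -> 0 < c ->
  (\int[mu]_(y in `]0%R, +oo[) ((y / c) `^ s * expR (- y))%:E < +oo)%E.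
Proof.
move=> s0 c0.
pose C := (2 * s / c) `^ s.
have C0 : 0 <= C by exact: powR_ge0.
apply: (@le_lt_trans _ _
    (\int[mu]_(y in `]0%R, +oo[) (C%:E * (expR (- (2^-1 * y)))%:E))%E).
  apply: ge0_le_integral => //=.
  - by move=> y _; rewrite lee_fin mulr_ge0 ?powR_ge0 ?expR_ge0.
  - exact: measurable_powR_expR.
  - apply: emeasurable_funM => //; exact: measurable_expR_opp.
  - move=> y; rewrite in_itv/= andbT => y0; rewrite -EFinM lee_fin.
    have -> : y / c = (2 * s / c) * (y / (2 * s)) by field; rewrite !gt_eqF.
    rewrite powRM ?divr_ge0 ?mulr_ge0 ?(ltW s0) ?(ltW c0) ?(ltW y0)//.
    rewrite -mulrA ler_wpM2l//.
    have -> : expR (- (2^-1 * y)) = expR (y / (2 * s)) `^ s * expR (- y).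
      rewrite -expRM -expRD; congr expR; field; rewrite gt_eqF//.
    rewrite ler_wpM2r ?expR_ge0// ge0_ler_powR ?nnegrE ?expR_ge0 ?(ltW s0)//.
      by rewrite divr_ge0 ?mulr_ge0 ?(ltW s0) ?(ltW y0).
    by apply: le_trans (expR_ge1Dx _); rewrite lerDr.
rewrite ge0_integralZl_EFin//=; last exact: measurable_expR_opp.
by rewrite integral_expR_tail ?invr_gt0// -EFinM ltry.
Qed.

Lemma powRV_half (r t : R) : 0 < r -> t `^ (r / 2)^-1 = (t `^ r^-1) ^+ 2.
Proof.
by move=> r0; rewrite invfM invrK powRrM powR_mulrn ?powR_ge0.
Qed.

(** Euler's integral in the variable [t = y `^ (r / 2)], up to an integration by
    parts. *)
Lemma Gamma_integral_expR (r : R) : 0 < r ->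
  (\int[mu]_(t in `[0%R, +oo[) (expR (- (t `^ r^-1) ^+ 2))%:E =
   (Gamma (1 + r / 2))%:E)%E.
Proof.
move=> r0; have s0 : 0 < r / 2 by rewrite divr_gt0.
have fin := integral_powR_expR_lty s0 ltr01.
transitivity (\int[mu]_(t in `[0%R, +oo[) (expR (- (1 * t `^ (r / 2)^-1)))%:E)%E.
  by apply: eq_integral => t _; rewrite mul1r powRV_half.
rewrite integral_expR_powR// /Gamma /Rintegral.
have e : (\int[mu]_(y in `]0%R, +oo[) ((y / 1) `^ (r / 2) * expR (- y))%:E =
   \int[mu]_(y in `]0%R, +oo[) (y `^ (1 + r / 2 - 1) * expR (- y))%:E)%E.
  by apply: eq_integral => y _; rewrite divr1 addrC addrA addNr add0r.
rewrite -e fineK// ge0_fin_numE//.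
by apply: integral_ge0 => y _; rewrite lee_fin mulr_ge0 ?powR_ge0 ?expR_ge0.
Qed.

Lemma integrable_expR_powR (r c : R) : 0 < r -> 0 < c ->
  mu.-integrable `[0%R, +oo[ (fun t => (expR (- (c * (t `^ r^-1) ^+ 2)))%:E).
Proof.
move=> r0 c0; have s0 : 0 < r / 2 by rewrite divr_gt0.
apply/integrableP; split.
  apply/measurable_EFinP; apply: measurable_funTS; apply: measurableT_comp => //.
  apply: measurableT_comp => //; apply: measurable_funM => //.
  by apply: measurable_funX; exact: measurable_powR.
rewrite [ltLHS](_ : _ =
  \int[mu]_(t in `[0%R, +oo[) (expR (- (c * t `^ (r / 2)^-1)))%:E)%E.
  by rewrite integral_expR_powR//; exact: integral_powR_expR_lty.
by apply: eq_integral => t _; rewrite powRV_half//= ger0_norm ?expR_ge0.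
Qed.

Lemma Gamma_three_halves : Gamma (1 + 1 / 2) = Num.sqrt pi / 2 :> R.
Proof.
apply: EFin_inj; rewrite -Gamma_integral_expR// -integral0y_gauss.
apply: eq_integral => t; rewrite inE/= in_itv/= andbT => t0.
by rewrite invr1 powRr1.
Qed.

Lemma Gamma_two : Gamma (1 + 2 / 2) = 1 :> R.
Proof.
apply: EFin_inj; rewrite -Gamma_integral_expR//.
transitivity (\int[mu]_(t in `]0%R, +oo[) (expR (- (1 * t)))%:E)%E; last first.
  by rewrite integral_expR_tail// mulr0 oppr0 expR0 divr1.
rewrite integral_itv_obnd_cbnd; last exact: measurable_expR_opp.
apply: eq_integral => t; rewrite inE/= in_itv/= andbT => t0.
by rewrite -powR_mulrn ?powR_ge0// -powRrM mulVf// powRr1// mul1r.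
Qed.

End gamma_layer_cake.

(** * Convergence of the survival function *)

Section survival_limit.
Variable R : realType.
Implicit Types (n k : nat) (z : R).

Definition rescaled_time n z : nat := Num.truncn (z * Num.sqrt n%:R).

(** The bound of [survival_tail_nat] at [j = 2 k / 5] covers all [k < n], and
    [survival] vanishes beyond.  The factor [expR 2] absorbs the rounding errors
    of [k] and [j], which only matter for [z * sqrt n <= 11]. *)
Lemma survival_tail n z : (2 < n)%N -> 0 <= z ->
  survival n R (rescaled_time n z) <= expR 2 * expR (- (100^-1 * z ^+ 2)).
Proof.
move=> n3 z0; set w := z * Num.sqrt n%:R; set k := rescaled_time n z.
have N0 : 0 < n%:R :> R by rewrite ltr0n; lia.
have w0 : 0 <= w by rewrite mulr_ge0 ?sqrtr_ge0.
have [nk|kn] := leqP n k.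
  by rewrite survival_eq0// mulr_ge0 ?expR_ge0.
pose j := (2 * k %/ 5)%N.
have jk : (j <= k)%N by rewrite /j; lia.
have := le_survival n R jk; move=> /le_trans; apply.
have j5 : (5 * j <= 2 * n)%N by rewrite /j; lia.
apply: le_trans (survival_tail_nat R n3 j5) _.
rewrite -expRD ler_expR.
have wk : w < k%:R + 1 by have := truncn_itv w0; rewrite -natr1 => /andP[].
have jw : 2 * w <= 5 * j%:R + 6.
  have : 2 * k%:R <= 5 * j%:R + 4 :> R by rewrite -!natrM -natrD ler_nat /j; lia.
  by lra.
have j0 : 0 <= j%:R * (j%:R - 1) :> R.
  case: (j) => [|i]; first by rewrite mul0r.
  by rewrite -natr1 addrK mulr_ge0.
have zw : z ^+ 2 = w ^+ 2 / n%:R.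
  by rewrite exprMn sqr_sqrtr ?ler0n// mulfK// gt_eqF.
(* Both [j] and [j - 1] exceed [w / 5] once [w > 11]; below, [200 * n] suffices. *)
have h : w ^+ 2 <= 25 * (j%:R * (j%:R - 1)) + 200 * n%:R.
  have n3' : 3 <= n%:R :> R by rewrite (ler_nat R 3).
  have [w11|w11] := leP w 11.
    apply: (@le_trans _ _ (11 ^+ 2)).
      by rewrite lerXn2r ?nnegrE.
    by rewrite (_ : 11 ^+ 2 = 121); [lra|ring].
  apply: (@le_trans _ _ (25 * ((w / 5) * (w / 5)))).
    by apply: ler_of_eq; field.
  by rewrite ler_wpDr// ler_wpM2l// ler_pM//; lra.
rewrite zw -subr_ge0 (_ : _ - _ =
  (25 * (j%:R * (j%:R - 1)) + 200 * n%:R - w ^+ 2) / (100 * n%:R)).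
  by rewrite divr_ge0// subr_ge0.
by field; rewrite gt_eqF.
Qed.

Lemma cvg_invr_sqrt : (Num.sqrt n%:R)^-1 @[n --> \oo] --> (0 : R).
Proof.
have n0 : (n%:R : R)^-1 @[n --> \oo] --> (0 : R).
  apply/gtr0_cvgV0; last exact: cvgr_idn.
  by near=> n; rewrite ltr0n; near: n; exact: nbhs_infty_gt.
rewrite (_ : (fun n => _) = fun n => Num.sqrt (n%:R^-1 : R)); last first.
  by apply/funext => n; rewrite sqrtrV.
by rewrite -[in X in _ --> X](@sqrtr0 R); apply: continuous_cvg => //; exact: sqrt_continuous.
Unshelve. all: end_near. Qed.

(** With [u = 1 / sqrt n], the lower and upper bounds at [k <= z / u < k + 1] are
    continuous functions of [u] at [0], both with value [expR (- z ^+ 2)]. *)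
Lemma survival_cvg z : 0 <= z ->
  survival n R (rescaled_time n z) @[n --> \oo] --> expR (- z ^+ 2).
Proof.
move=> z0; pose u n : R := (Num.sqrt n%:R)^-1.
have u0 : u n @[n --> \oo] --> (0 : R) by exact: cvg_invr_sqrt.
have zu : 3 * z * u n @[n --> \oo] --> (0 : R).
  by rewrite -(mulr0 (3 * z)); apply: cvgM => //; exact: cvg_cst.
apply: (@squeeze_cvgr _ _ _ _
  (fun n => expR (- (z ^+ 2 / (1 - 3 * z * u n))))
  (fun n => expR (- (z ^+ 2 - 3 * z * u n)) + 12 * z ^+ 3 * u n)).
- near=> n.
  have n5 : (5 <= n)%N by near: n; exact: nbhs_infty_ge.
  have N0 : 0 < n%:R :> R by rewrite ltr0n; lia.
  have S0 : 0 < Num.sqrt n%:R :> R by rewrite sqrtr_gt0.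
  have hu : 3 * z * u n < 1.
    by near: n; exact: (cvgr_lt 0).
  have SN : Num.sqrt n%:R ^+ 2 = n%:R :> R by rewrite sqr_sqrtr ?ler0n.
  set k := rescaled_time n z; set S := Num.sqrt n%:R in S0 SN.
  have /truncn_itv/andP[kw wk] : 0 <= z * S by rewrite mulr_ge0// ltW.
  rewrite -[Num.trunc _]/k -natr1 in kw wk.
  have z3S : 3 * z < S by move: hu; rewrite /u ltr_pdivrMr// mul1r.
  have zS : 3 * (z * S) < n%:R.
    by rewrite -SN expr2 mulrA ltr_pM2r.
  have k3 : (3 * k < n)%N.
    by rewrite -(ltr_nat R) natrM; apply: le_lt_trans zS; rewrite ler_wpM2l.
  apply/andP; split.
    apply: le_trans (survival_lower_bound R _ k3); last by lia.
    rewrite ler_expR lerN2.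
    have D0 : 0 < n%:R - 3 * k%:R :> R by rewrite subr_gt0 -natrM ltr_nat.
    have hu' : 0 < 1 - 3 * z * u n by rewrite subr_gt0.
    apply: (@le_trans _ _ ((z * S) ^+ 2 / (n%:R - 3 * (z * S)))).
      rewrite ler_pM ?invr_ge0 ?exprn_ge0 ?(ltW D0)//.
        by rewrite lerXn2r ?nnegrE// mulr_ge0// ltW.
      rewrite lef_pV2 ?posrE ?subr_gt0//; last by rewrite -natrM ltr_nat.
      by rewrite lerD2l lerN2 ler_wpM2l.
    rewrite -SN; apply: ler_of_eq; rewrite /u -/S.
    by field; rewrite SN !gt_eqF ?subr_gt0.
  apply: le_trans (survival_upper_bound R n5 (ltnW k3)) _.
  rewrite lerD//.
    rewrite ler_expR lerN2 ler_pdivlMr// /u -/S -SN.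
    rewrite (_ : _ * S ^+ 2 = (z * S) ^+ 2 - 3 * (z * S)); last by field; rewrite gt_eqF.
    move: kw wk (ler0n R k) (mulr_ge0 z0 (ltW S0)); move: (z * S) (k%:R) => w K.
    move=> kw wk K0 w0.
    (* [K >= w - 1] cannot be squared when [w < 1]. *)
    have h : w ^+ 2 - 2 * w <= K ^+ 2.
      have [w2|w2] := leP w 2.
        apply: (@le_trans _ _ 0); last exact: sqr_ge0.
        by rewrite expr2 -mulrBl mulr_le0_ge0// subr_le0.
      apply: (@le_trans _ _ ((w - 1) ^+ 2)); first by rewrite sqrrB1 -mulr_natl; lra.
      by rewrite lerXn2r ?nnegrE//; lra.
    by rewrite mulrBr mulr1 -expr2; lra.
  rewrite -mulrA [leRHS](_ : _ = 12 * ((z * S) ^+ 3 / n%:R ^+ 2)); last first.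
    by rewrite -SN /u -/S; field; rewrite gt_eqF.
  rewrite ler_wpM2l// ler_wpM2r ?invr_ge0 ?exprn_ge0// lerXn2r// nnegrE.
    by [].
  by rewrite mulr_ge0// ltW.
- apply: continuous_cvg; first exact: continuous_expR.
  apply: cvgN; rewrite -[X in _ --> X]divr1; apply: cvgM; first exact: cvg_cst.
  apply: cvgV => //; rewrite -[X in _ --> X]subr0.
  by apply: cvgB => //; exact: cvg_cst.
- rewrite -[X in _ --> X]addr0; apply: cvgD.
    apply: continuous_cvg; first exact: continuous_expR.
    apply: cvgN; rewrite -[X in _ --> X]subr0.
    by apply: cvgB => //; exact: cvg_cst.
  by rewrite -(mulr0 (12 * z ^+ 3)); apply: cvgM => //; exact: cvg_cst.
Unshelve. all: end_near. Qed.

End survival_limit.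

(** * Convergence of the moments *)

Section expectation_of_the_gap.
Variable R : realType.

Lemma measurable_perm n (X : 'S_n -> R) : measurable_fun setT X.
Proof. by []. Qed.

(** The uniform probability is a multiple of a finite sum of Dirac measures. *)
Lemma expectation_uniform_perm n (X : 'S_n -> R) : (forall s, 0 <= X s) ->
  ('E_(@uniform_perm R n)[X] = (mean X)%:E)%E.
Proof.
move=> X0; have mX : measurable_fun setT (EFin \o X) by [].
have {}X0 s : setT s -> (0 <= (X s)%:E)%E by rewrite lee_fin.
rewrite unlock; pose r := index_enum (perm_type 'I_n).
rewrite (@eq_measure_integral _ _ _ _ (mscale ((n`!%:R : R)^-1)%:nng%R
    (msum (fun i => \d_(nth 1%g r i)) (size r)))); last first.
  move=> A _ _; rewrite /= /mscale /msum /uniform_perm /= mulrC EFinM.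
  by rewrite (big_nth 1%g) big_mkord -sumEFin.
rewrite ge0_integral_mscale// ge0_integral_measure_sum//.
under eq_bigr do rewrite integral_dirac// diracT mul1e.
by rewrite sumEFin -EFinM /mean mulrC (big_nth 1%g) big_mkord.
Qed.

Lemma uniform_perm_mean n (A : pred 'S_n) :
  uniform_perm R [set s | A s] = (mean (fun s => (A s)%:R : R))%:E.
Proof.
rewrite /uniform_perm /mean; congr (_ / _)%:E; apply: eq_bigr => s _.
by rewrite indicE; congr (nat_of_bool _)%:R; apply/idP/idP; rewrite inE.
Qed.

Definition scaled_gap_powR (r : R) n (s : 'S_n) : R :=
  ((isolation_gap s)%:R / Num.sqrt n%:R) `^ r.

Lemma scaled_gap_powR_ge0 r n (s : 'S_n) : 0 <= scaled_gap_powR r s.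
Proof. exact: powR_ge0. Qed.

Definition scaled_gap_RV (r : R) n : {RV (@uniform_perm R n) >-> R} :=
  mfun_Sub (mem_set (measurable_perm (@scaled_gap_powR r n))).

(** [K_n] is an integer, so exceeding [z * sqrt n] means exceeding its floor. *)
Lemma ccdf_scaled_gap (r t : R) n : (0 < n)%N -> 0 < r -> 0 <= t ->
  ccdf (scaled_gap_RV r n) t = (survival n R (rescaled_time n (t `^ r^-1)))%:E.
Proof.
move=> n0 r0 t0; rewrite /ccdf /distribution /= /pushforward /=.
rewrite /survival -uniform_perm_mean; congr uniform_perm.
have S0 : 0 < Num.sqrt n%:R :> R by rewrite sqrtr_gt0 ltr0n.
apply: eq_set => s; rewrite /= in_itv/= andbT /scaled_gap_powR.
rewrite -ltr_powRV ?divr_ge0 ?(ltW S0)// ltr_pdivlMr// /rescaled_time truncn_lt_nat//.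
by rewrite mulr_ge0 ?powR_ge0 ?(ltW S0).
Qed.

(** Dominated convergence in the tail formula for expectations; the tail bound
    requires [n > 2], hence the shift by [3]. *)
Lemma cvg_moment_scaled_gap (r : R) : 0 < r ->
  'E_(@uniform_perm R n)[@scaled_gap_powR r n]%E @[n --> \oo] -->
  (Gamma (1 + r / 2))%:E.
Proof.
move=> r0; rewrite -Gamma_integral_expR//.
have eE n : ('E_(@uniform_perm R n)[@scaled_gap_powR r n] =
   \int[lebesgue_measure]_(t in `[0%R, +oo[) ccdf (scaled_gap_RV r n) t)%E.
  by rewrite -ge0_expectation_ccdf//; exact: scaled_gap_powR_ge0.
suff : (\int[lebesgue_measure]_(t in `[0%R, +oo[)
      ccdf (scaled_gap_RV r (n + 3)) t)%E @[n --> \oo] -->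
    (\int[lebesgue_measure]_(t in `[0%R, +oo[) (expR (- (t `^ r^-1) ^+ 2))%:E)%E.
  rewrite (cvg_shiftn 3 (fun n => (\int[lebesgue_measure]_(t in `[0%R, +oo[)
      ccdf (scaled_gap_RV r n) t)%E)).
  by under eq_fun do rewrite -eE.
(* [GR] is the line with its Borel sets. *)
pose GR := measurableTypeR R.
pose D : set GR := `[0, +oo[%classic.
pose f_ n (t : GR) := ccdf (scaled_gap_RV r (n + 3)) t.
pose f (t : GR) := (expR (- (t `^ r^-1) ^+ 2))%:E.
pose g (t : GR) := ((expR 2)%:E * (expR (- (100^-1 * (t `^ r^-1) ^+ 2)))%:E)%E.
have mD : measurable D by exact: measurable_itv.
have fE n t : D t -> f_ n t = (survival (n + 3) R (rescaled_time (n + 3) (t `^ r^-1)))%:E.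
  by rewrite /D /= in_itv/= andbT => t0; rewrite /f_ ccdf_scaled_gap ?addn3.
have mf n : measurable_fun D (f_ n).
  by apply: measurable_funTS; exact: ccdf_measurable.
have ff t : D t -> f_ n t @[n --> \oo] --> f t.
  move=> Dt; rewrite (_ : (fun n => f_ n t) = EFin \o
    (fun n => survival (n + 3) R (rescaled_time (n + 3) (t `^ r^-1)))); last first.
    by apply/funext => n; rewrite /= fE.
  apply: cvg_EFin; first by near=> n.
  rewrite (cvg_shiftn 3 (fun n => survival n R (rescaled_time n (t `^ r^-1)))).
  by apply: survival_cvg; exact: powR_ge0.
have ig : lebesgue_measure.-integrable D g.
  have c0 : 0 < 100^-1 :> R by rewrite invr_gt0.
  exact: (integrableZl mD (expR 2) (integrable_expR_powR r0 c0)).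
have fg n t : D t -> (`|f_ n t| <= g t)%E.
  move=> Dt; rewrite fE//= ger0_norm ?survival_ge0// /g -EFinM lee_fin.
  by apply: survival_tail; [lia|exact: powR_ge0].
exact: (dominated_cvg mD mf ff _ ig fg).
Unshelve. all: end_near. Qed.

End expectation_of_the_gap.

(** * Mean and variance *)

Section asymptotics.
Variable R : realType.

Local Notation mean_gap := (fun n => mean (fun s : 'S_n => (isolation_gap s)%:R : R)).

Lemma cvg_mean_scaled_gap_powR (r : R) : 0 < r ->
  mean (@scaled_gap_powR R r n) @[n --> \oo] --> Gamma (1 + r / 2).
Proof.
move=> /cvg_moment_scaled_gap/fine_cvg; apply: cvg_trans.
apply: near_eq_cvg; near=> n => /=.
by rewrite expectation_uniform_perm//; exact: scaled_gap_powR_ge0.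
Unshelve. all: end_near. Qed.

Lemma cvg_mean_gap :
  mean_gap n / Num.sqrt n%:R @[n --> \oo] --> (Num.sqrt pi / 2 : R).
Proof.
rewrite -Gamma_three_halves; have := @cvg_mean_scaled_gap_powR 1 ltr01.
apply: cvg_trans; apply: near_eq_cvg; near=> n.
rewrite mulrC -meanZ; apply: eq_mean => s.
by rewrite /scaled_gap_powR powRr1 1?mulrC// divr_ge0 ?sqrtr_ge0.
Unshelve. all: end_near. Qed.

Lemma cvg_mean_gap_sqr :
  mean (fun s : 'S_n => (isolation_gap s)%:R ^+ 2) / n%:R @[n --> \oo] --> (1 : R).
Proof.
rewrite -[X in _ --> X]Gamma_two; have := @cvg_mean_scaled_gap_powR 2 (ltr0Sn _ 1).
apply: cvg_trans; apply: near_eq_cvg; near=> n.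
rewrite mulrC -meanZ; apply: eq_mean => s.
rewrite /scaled_gap_powR powR_mulrn ?divr_ge0 ?sqrtr_ge0//.
by rewrite exprMn exprVn sqr_sqrtr// mulrC.
Unshelve. all: end_near. Qed.

Lemma expectation_gap n :
  ('E_(@uniform_perm R n)[fun s : 'S_n => (isolation_gap s)%:R%R] =
   (mean_gap n)%:E)%E.
Proof. by rewrite expectation_uniform_perm. Qed.

Lemma variance_gap n :
  ('V_(@uniform_perm R n)[fun s : 'S_n => (isolation_gap s)%:R%R] =
   (mean (fun s : 'S_n => (isolation_gap s)%:R ^+ 2) - mean_gap n ^+ 2)%:E)%E.
Proof.
rewrite /variance unlock expectation_gap /= expectation_uniform_perm; last first.
  by move=> s /=; rewrite -expr2 sqr_ge0.
congr EFin; set m := mean_gap n.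
rewrite (@eq_mean _ _ _ (fun s : 'S_n => (isolation_gap s)%:R ^+ 2 +
    ((- (2 * m)) * (isolation_gap s)%:R + m ^+ 2))); last first.
  move=> s; rewrite !fctE /= -/m; ring.
by rewrite 2!meanD meanZ mean_cst -/m; ring.
Qed.

Lemma expectation_last_isolated_time n :
  ('E_(@uniform_perm R n)[fun s : 'S_n => (last_isolated_time s)%:R%R] =
   (n%:R - mean_gap n)%:E)%E.
Proof.
rewrite expectation_uniform_perm//; congr EFin.
rewrite -[n%:R](@mean_cst n) -mulN1r -meanZ -meanD; apply: eq_mean => s.
rewrite mulN1r /isolation_gap natrB ?subKr//.
by apply/bigmax_leqP => t _; rewrite -ltnS.
Qed.

End asymptotics.

Theorem theorem5p2 (R : realType) :
  [/\ (forall r : R, 0 < r ->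
         'E_(@uniform_perm R n)
           [fun s : 'S_n => (((isolation_gap s)%:R / Num.sqrt n%:R) `^ r)%R]%E
         @[n --> \oo] --> (Gamma (1 + r / 2))%:E),
      asymp_equiv
        (fun n =>
           fine 'E_(@uniform_perm R n)[fun s : 'S_n => (isolation_gap s)%:R%R]%E)
        (fun n => Num.sqrt pi / 2 * Num.sqrt n%:R),
      asymp_equiv
        (fun n =>
           fine 'V_(@uniform_perm R n)[fun s : 'S_n => (isolation_gap s)%:R%R]%E)
        (fun n => (1 - pi / 4) * n%:R)
    & (fun n =>
         fine 'E_(@uniform_perm R n)
           [fun s : 'S_n => (last_isolated_time s)%:R%R]%E) =
      (fun n => n%:R - Num.sqrt pi / 2 * Num.sqrt n%:R)
      +o_\oo (fun n => Num.sqrt n%:R : R) ].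
Proof.
have pi0 : 0 < Num.sqrt pi / 2 :> R by rewrite divr_gt0// sqrtr_gt0 pi_gt0.
split.
- exact: cvg_moment_scaled_gap.
- rewrite /asymp_equiv -[X in _ --> X](divff (lt0r_neq0 pi0)).
  under eq_fun do rewrite expectation_gap /=.
  under eq_fun do rewrite invfM mulrCA mulrC.
  by apply: cvgM; [exact: cvg_mean_gap|exact: cvg_cst].
- have pi4 : 0 < 1 - pi / 4 :> R by have := @pihalf_lt2 R; lra.
  rewrite /asymp_equiv -[X in _ --> X](divff (lt0r_neq0 pi4)).
  under eq_fun do rewrite variance_gap /=.
  under eq_fun do rewrite invfM mulrCA mulrC mulrBl.
  apply: cvgM; last exact: cvg_cst.
  apply: cvgB; first exact: cvg_mean_gap_sqr.
  have -> : pi / 4 = (Num.sqrt pi / 2) ^+ 2 :> R.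
    by rewrite exprMn sqr_sqrtr ?pi_ge0// exprVn; congr (_ / _); ring.
  rewrite expr2; apply: cvg_trans (cvgM (@cvg_mean_gap R) (@cvg_mean_gap R)).
  by apply: near_eq_cvg; near=> n; rewrite /= -expr2 exprMn exprVn sqr_sqrtr.
- apply/eqaddoP => e e0; near=> n.
  have S0 : 0 < Num.sqrt n%:R :> R.
    by rewrite sqrtr_gt0 ltr0n; near: n; exact: nbhs_infty_gt.
  rewrite !fctE expectation_last_isolated_time /= -ler_pdivrMr ?normr_gt0 ?gt_eqF//.
  rewrite -normfV -normrM.
  rewrite [X in `|X|](_ : _ = Num.sqrt pi / 2 -
    mean (fun s : 'S_n => (isolation_gap s)%:R) / Num.sqrt n%:R); last first.
    by field; rewrite gt_eqF.
  near: n; move: e e0; apply/cvgrPdist_le; exact: cvg_mean_gap.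
Unshelve. all: end_near. Qed.
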